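(* Let $n\ge1$ and $\nu$ be fixed integers with $n\le\nu/2$. For $G\in\{\mathbb{T},SO(2),O(3)\}$ let $\mathcal{A}_G(\nu,D)$ be the set of auxiliary nodes inserted by Algorithm 2 (specified in the context) with parameter $n$, and let $\mathcal{V}_G(\nu,D)=\mathcal{A}_G(\nu,D)\cup\bigcup_{\nu'=1}^{\nu}\mathcal{K}_G(\nu',D)$. Then, as $D\to\infty$, $$\frac{\#\mathcal{A}_{G}(\nu,D)}{\#\mathcal{V}_{G}(\nu,D)}=\begin{cases}O(D^{1-n}), & G=\mathbb{T},\\ O(D^{1-2n}), & G=SO(2),\\ O(D^{1-3n}), & G=O(3).\end{cases}$$
   Context: $D$ ranges over positive integers, $\mathbb{Z}_+=\{0,1,2,\dots\}$, $\#$ denotes cardinality, and $[\cdot]$ denotes a multiset (unordered, with repetitions). A multi-index (node) is a finite multiset $\mathbf{k}=[k^1,\dots,k^\nu]$ of one-particle indices; $\nu=\nu(\mathbf{k})=\mathrm{len}(\mathbf{k})\ge 1$ is its correlation order. The one-particle indices are: $k^t=m^t\in\mathbb{Z}$ if $G=\mathbb{T}$; $k^t=(n^t,m^t)\in\mathbb{Z}_+\times\mathbb{Z}$ if $G=SO(2)$; $k^t=(n^t,l^t,m^t)\in\mathbb{Z}_+\times\mathbb{Z}_+\times\mathbb{Z}$ with $|m^t|\le l^t$ if $G=O(3)$. (The components $n^t$ are unrelated to the algorithm parameter $n$.) The set $\mathcal{K}^{\rm inv}_G$ of invariant multi-indices consists of all multisets $\mathbf{k}$ (of any order $\nu\ge1$)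 of one-particle indices with $\sum_t m^t=0$ and, if $G=O(3)$, additionally $\sum_t l^t$ even. The degree of a one-particle index $k$ is $|m|$ for $\mathbb{T}$, $n+|m|$ for $SO(2)$, $n+l$ for $O(3)$ (where $n$ here is the component of $k$), and the total degree $\|\mathbf{k}\|_1$ of a multi-index is the sum of the degrees of its elements. Set $$\mathcal{K}_G(\nu,D)=\{\mathbf{k}\in\mathcal{K}^{\rm inv}_G : \|\mathbf{k}\|_1\le D,\ \nu(\mathbf{k})=\nu\}.$$ A decomposition $\mathbf{k}\equiv[\mathbf{k}_1,\mathbf{k}_2]$ means that $\mathbf{k}$ is the multiset union (multiplicities added) of two nonempty multisets $\mathbf{k}_1,\mathbf{k}_2$ of one-particle indices (not necessarily invariant). Graph construction. The computational graph $\mathcal{G}$ initially contains all order-one nodes $[k]$ with $\|[k]\|_1\le D$. Then all elements of $\mathcal{K}_G(\nu',D)$, $\nu'=1,\dots,\nu$, are inserted one by one in increasing order of correlation $\nu'$ (arbitrary order within the same $\nu'$), each by calling Insert($\mathbf{k},n$). Algorithm 2, Insert($\mathbf{k},n$): (1) If $\mathbf{k}\in\mathcal{G}$, return. (2) If there is a decomposition $\mathbf{k}\equiv[\mathbf{k}_1,\mathbf{k}_2]$ with $\mathbf{k}_1,\mathbf{k}_2\in\mathcal{G}$, add $\mathbf{k}$ to $\mathcal{G}$ (with this decomposition) and return. (3) Otherwise write $\mathbf{k}\equiv[[k^1,\dots,k^s],\mathbf{k}']$, where $[k^1,\dots,k^s]$ is a sub-multiset of $\mathbf{k}$ with $1\le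 s\le\min(n,\mathrm{len}(\mathbf{k})-1)$ whose total degree $\|[k^1,\dots,k^s]\|_1$ is maximal among all such sub-multisets (ties broken arbitrarily); call Insert($[k^1,\dots,k^s],1$), then Insert($\mathbf{k}',n$), then Insert($\mathbf{k},n$), and return. The set $\mathcal{A}_G(\nu,D)$ of auxiliary nodes consists of the nodes of the final graph of correlation order at least $2$ that do not belong to $\bigcup_{\nu'=1}^{\nu}\mathcal{K}_G(\nu',D)$ (the initial order-one nodes are not counted as auxiliary). *)

(* Defs.v *)
From HB Require Import structures.
From mathcomp Require Import all_boot all_order all_algebra.
From mathcomp Require Import finmap multiset.
From mathcomp Require Import all_classical all_reals all_analysis.

Set Implicit Arguments.
Unset Strict Implicit.
Unset Printing Implicit Defensive.

Import Order.TTheory GRing.Theory Num.Theory.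

Local Open Scope nat_scope.
Local Open Scope mset_scope.
Local Open Scope classical_set_scope.

Inductive symmetry_group := Torus | SO2 | O3.

(* One-particle indices: m, (n, m) and (n, l, m) with |m| <= l respectively. *)
Definition particle (G : symmetry_group) : choiceType :=
  match G with
  | Torus => int
  | SO2 => (nat * int)%type
  | O3 => {k : nat * nat * int | `|k.2|%N <= k.1.2}
  end.

Definition particle_m (G : symmetry_group) : particle G -> int :=
  match G with
  | Torus => fun k => k
  | SO2 => fun k => k.2
  | O3 => fun k => (val k).2
  end.

Definition particle_degree (G : symmetry_group) : particle G -> nat :=
  match G with
  | Torus => fun k => `|k|%N
  | SO2 => fun k => k.1 + `|k.2|%N
  | O3 => fun k => (val k).1.1 + (val k).1.2
  end.

(* Multi-indices, not necessarily invariant. *)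
Notation node G := {mset particle G}%mset.

Definition even_l (G : symmetry_group) : node G -> bool :=
  match G with
  | O3 => fun k => ~~ odd (\sum_(i <- k) (val i).1.2)
  | _ => fun _ => true
  end.

Definition degree (G : symmetry_group) (k : node G) : nat :=
  \sum_(i <- k) particle_degree i.

(* The correlation order of k is [size k], multiplicities included. *)
Definition invariant_nodes (G : symmetry_group) : set (node G) :=
  [set k : node G |
    [/\ 1 <= size k, (\sum_(i <- k) particle_m i)%R = 0%R & even_l k]].
Arguments invariant_nodes : clear implicits.

Definition K_set (G : symmetry_group) (nu D : nat) : set (node G) :=
  [set k : node G |
    [/\ invariant_nodes G k, degree k <= D & size k = nu]].
Arguments K_set : clear implicits.

Definition K_upto (G : symmetry_group) (nu D : nat) : set (node G) :=
  \bigcup_(nu' in [set i | 1 <= i <= nu]) K_set G nu' D.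
Arguments K_upto : clear implicits.

Section Algorithm.
Variable G : symmetry_group.
Implicit Types (k p : node G) (S : set (node G)).

Definition decomposes_in S k : Prop :=
  exists k1 k2 : node G,
    [/\ k = (k1 `+` k2)%mset, k1 != mset0, k2 != mset0, S k1 & S k2].

Definition admissible_block (n : nat) k p : Prop :=
  (p `<=` k)%mset /\ 1 <= size p <= minn n (size k).-1.

Definition maximal_block (n : nat) k p : Prop :=
  admissible_block n k p /\
  forall q, admissible_block n k q -> degree q <= degree p.

(* [insert n k S S']: a call of Insert(k, n) on the node set S can return with
   the node set S'; it is a relation because ties in the choice of the block
   are broken arbitrarily. The edges of the graph are not recorded, as the
   choice of a decomposition has no influence on the node set. *)
Inductive insert : nat -> node G -> set (node G) -> set (node G) -> Prop :=
| insert_present n k S :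
    S k -> insert n k S S
| insert_decompose n k S :
    ~ S k -> decomposes_in S k -> insert n k S (S `|` [set k])
| insert_split n k p k' S S1 S2 S3 :
    ~ S k -> ~ decomposes_in S k ->
    k = (p `+` k')%mset -> maximal_block n k p ->
    insert 1 p S S1 -> insert n k' S1 S2 -> insert n k S2 S3 ->
    insert n k S S3.

Inductive insert_seq (n : nat) :
    seq (node G) -> set (node G) -> set (node G) -> Prop :=
| insert_nil S : insert_seq n [::] S S
| insert_cons k s S S1 S2 :
    insert n k S S1 -> insert_seq n s S1 S2 -> insert_seq n (k :: s) S S2.

Definition initial_nodes (D : nat) : set (node G) :=
  [set k : node G | size k = 1 /\ degree k <= D].

(* The possible node sets of the final graph. *)
Definition final_graph (n nu D : nat) (S : set (node G)) : Prop :=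
  exists s : seq (node G),
    [/\ uniq s, (forall k, k \in s <-> K_upto G nu D k),
        sorted (fun k1 k2 : node G => size k1 <= size k2) s
      & insert_seq n s (initial_nodes D) S].

Definition auxiliary_nodes (nu D : nat) S : set (node G) :=
  [set k : node G | [/\ S k, 2 <= size k & ~ K_upto G nu D k]].

Definition V_set (nu D : nat) S : set (node G) :=
  auxiliary_nodes nu D S `|` K_upto G nu D.

End Algorithm.

(* [fset_set A] enumerates A if A is finite and is empty otherwise; the node sets
   of final graphs, hence the sets to be counted, are finite. *)
Definition set_card (T : choiceType) (A : set T) : nat := #|` fset_set A|%fset.

(* Main.v *)
(* Write d = 1, 2, 3 for T, SO(2), O(3), so that about D^d one-particle indices
   have degree at most D.  When Insert(k, n) splits k into a block p and a
   remainder k', every node it adds, except k itself, is a sub-multiset of p or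
   of k'.  The block has at most n <= nu - n elements.  If it has min(n, len k - 1)
   elements, then the remainder has at most nu - n elements; if it has fewer, then
   by maximality of its degree all elements of k' have degree 0, and every
   sub-multiset of k' is an invariant node.  Hence auxiliary nodes have order at
   most nu - n, and there are O(D^(d (nu - n))) of them.  The only constraint of
   positive codimension on an invariant node of order nu is the vanishing of the
   sum of the m's, hence there are at least c D^(d nu - 1) of them. *)
Require Import Defs.
From mathcomp Require Import all_boot all_order all_algebra finmap multiset.
From mathcomp Require Import all_classical all_reals all_analysis.
From mathcomp Require Import zify.

Set Implicit Arguments.
Unset Strict Implicit.
Unset Printing Implicit Defensive.

Import Order.TTheory GRing.Theory Num.Theory.
Import numFieldNormedType.Exports.
Local Open Scope classical_set_scope.
Local Open Scope ring_scope.
Local Open Scope nat_scope.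

(** * Nodes that the insertion algorithm can add *)

Lemma insert_sub G n (k : node G) S S' : insert n k S S' ->
  forall q, S' q -> S q \/ (q `<=` k)%mset.
Proof.
elim=> {n k S S'} [n k S _ q|n k S _ _ q|n k p k' S S1 S2 S3 _ _ -> _ _ IH1 _ IH2 _ IH3 q].
- by left.
- by case=> [|->]; [left | right; exact: msubset_refl].
- move=> /IH3[|]; last by right.
  move=> /IH2[|qk']; last first.
    right; apply: msubset_trans qk' _; apply/msubsetP => x.
    by rewrite msetE2 leq_addl.
  move=> /IH1[|qp]; first by left.
  right; apply: msubset_trans qp _; apply/msubsetP => x.
  by rewrite msetE2 leq_addr.
Qed.

Lemma perm_msetD (K : choiceType) (A B : {mset K}%mset) :
  perm_eq (A `+` B)%mset (enum_mset A ++ enum_mset B).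
Proof. by apply/allP => x _; rewrite /= count_cat !count_mem_mset msetE2. Qed.

Lemma size_msetD (K : choiceType) (A B : {mset K}%mset) :
  size (A `+` B)%mset = size A + size B.
Proof. by rewrite (perm_size (perm_msetD A B)) size_cat. Qed.

Lemma size_msubset (K : choiceType) (A B : {mset K}%mset) :
  (A `<=` B)%mset -> size A <= size B.
Proof. by move=> /msetBDKC <-; rewrite size_msetD leq_addr. Qed.

Lemma degreeD G (A B : node G) : degree (A `+` B)%mset = degree A + degree B.
Proof. by rewrite /degree (perm_big _ (perm_msetD A B)) big_cat. Qed.

Lemma degree_msubset G (A B : node G) :
  (A `<=` B)%mset -> degree A <= degree B.
Proof. by move=> /msetBDKC <-; rewrite degreeD leq_addr. Qed.

Lemma particle_degree_le G (k : node G) i : i \in k -> particle_degree i <= degree k.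
Proof. by move=> ik; rewrite /degree (big_rem i ik) /= leq_addr. Qed.

(* If a block of maximal degree has fewer than the allowed number of elements,
   then adding an element of the remainder would not increase its degree. *)
Lemma maximal_block_rem G n (p k' : node G) :
    maximal_block n (p `+` k')%mset p ->
  [\/ size k' <= size (p `+` k')%mset - n, size k' <= 1 | degree k' = 0].
Proof.
move=> [[_ sp] maxp].
have [|small] := leqP (minn n (size (p `+` k')%mset).-1) (size p).
  by rewrite size_msetD => ?; have [?|?] := leqP (size k') 1;
    [apply: Or32|apply: Or31]; lia.
apply: Or33; apply/eqP; rewrite /degree sum_nat_seq_eq0.
apply/allP => x xk'; apply/implyP => _.
have /maxp : admissible_block n (p `+` k')%mset (p `+` [mset x])%mset.
  split; first by apply: msetDS; rewrite msub1set.
  by rewrite size_msetD enum_msetn /=; lia.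
by rewrite degreeD [degree [mset x]%mset]/degree big_msetn /=; lia.
Qed.

(** Sub-multisets of the block have at most [n] elements. For those of the remainder,
    [maximal_block_rem] leaves at most [size k - n] elements, at most one (and [1 <= n]), or degree
    0. The calls on block and remainder only need [insert_sub]; the induction serves the repeated
    call on [k]. *)
Lemma insert_new G n (k : node G) S S' : insert n k S S' -> 0 < n ->
  forall q, S' q -> [\/ S q, q = k |
    (q `<=` k)%mset /\ (size q <= maxn n (size k - n) \/ degree q = 0)].
Proof.
elim=> {n k S S'} [n k S _|n k S _ _|n k p k' S S1 S2 S3 _ _ kE maxp ins1 _ ins2 _ _ IH3] n0 q.
- by apply: Or31.
- by case=> [|->]; [apply: Or31 | apply: Or32].
have ple : size p <= n by case: maxp => -[_]; lia.
have pk : (p `<=` k)%mset by rewrite kE; apply/msubsetP => x; rewrite msetE2 leq_addr.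
have k'k : (k' `<=` k)%mset by rewrite kE; apply/msubsetP => x; rewrite msetE2 leq_addl.
case/(IH3 n0); [|exact: Or32|exact: Or33].
move=> /(insert_sub ins2)[/(insert_sub ins1)[|qp]|qk'].
- exact: Or31.
- apply: Or33; split; first exact: msubset_trans qp pk.
  by left; have := size_msubset qp; lia.
- apply: Or33; split; first exact: msubset_trans qk' k'k.
  have := size_msubset qk'; have := degree_msubset qk'.
  by move: maxp; rewrite kE => /maximal_block_rem[]; lia.
Qed.

(** From [2 * n <= nu] comes [n <= nu - n], so [maxn n (size k - n)] is at most [nu - n]. *)
Lemma insert_seq_new G n nu D (s : seq (node G)) S S' :
    insert_seq n s S S' -> 0 < n -> 2 * n <= nu ->
    (forall k, k \in s -> K_upto G nu D k) ->
  forall q, S' q -> [\/ S q, K_upto G nu D q |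
    degree q <= D /\ (size q <= nu - n \/ size q <= nu /\ degree q = 0)].
Proof.
elim=> {s S S'} [S|k s S S1 S2 ins _ IH] n0 n_le sK q; first exact: Or31.
case/IH=> //; [|move=> Sq|exact: Or32|exact: Or33].
  by move=> k' k's; apply: sK; rewrite inE k's orbT.
have Kk : K_upto G nu D k by apply: sK; rewrite mem_head.
case: (insert_new ins n0 Sq) => [|->|[qk sq]]; [exact: Or31|exact: Or32|].
apply: Or33; case: Kk => nu' /= nu'P [_ degk sizek].
have := size_msubset qk; have := degree_msubset qk; lia.
Qed.

Lemma absz_particle_m G (i : particle G) : `|particle_m i| <= particle_degree i.
Proof. by case: G i => [m|[a m]|[[[a l] m] /= lm]] //=; lia. Qed.

(** Degree 0 forces every [m], and for [O3] every [l], to vanish. Hence no node of degree 0 and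
    order at most [nu] is auxiliary. *)
Lemma degree0_invariant G (k : node G) :
  1 <= size k -> degree k = 0 -> invariant_nodes G k.
Proof.
move=> k1 k0; have deg0 i : i \in k -> particle_degree i = 0.
  by move=> /particle_degree_le; lia.
split=> //.
  rewrite big_seq big1// => i /deg0; have := absz_particle_m i; lia.
case: G k k1 k0 deg0 => //= k _ _ deg0.
by rewrite big_seq big1// => i /deg0 /=; lia.
Qed.

Lemma auxiliary_bounded G n nu D (S : set (node G)) q :
    0 < n -> 2 * n <= nu -> final_graph n nu D S ->
    auxiliary_nodes nu D S q ->
  size q <= nu - n /\ degree q <= D.
Proof.
move=> n0 n_le [s [_ sK _ ins]] [Sq q2 nKq].
have [//|||] := insert_seq_new (D := D) ins n0 n_le _ Sq.
- by move=> k /sK.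
- by move=> -[] /= q1; lia.
- by [].
- move=> [degq [//|[sq dq]]]; case: nKq; exists (size q) => /=; first lia.
  by split=> //; apply: degree0_invariant => //; lia.
Qed.

(** * Cardinality bounds for finite sets *)

(** Finiteness comes with the bound because [set_card] is 0 on infinite sets. *)
Lemma set_card_le_surj (T : choiceType) (F : finType) (f : F -> T) (A : set T) :
  (forall y, A y -> exists x, f x = y) -> finite_set A /\ set_card A <= #|F|.
Proof.
move=> fA; have finA : finite_set A.
  apply: (@sub_finite_set _ _ (range f)); last exact/finite_image/finite_finset.
  by move=> y /fA[x <-]; exists x.
split=> //; rewrite cardE -(size_map f); apply: uniq_leq_size => // y.
rewrite in_fset_set// inE => /fA[x <-]; apply: map_f; exact: mem_enum.
Qed.

(** The map [h] separates the points of each fibre of [f], so every fibre has at most [#|H|]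
    elements. *)
Lemma card_le_fibered (T : choiceType) (F H : finType) (f : F -> T) (h : F -> H)
    (A : set T) :
    finite_set A -> (forall x, A (f x)) -> injective (fun x => (f x, h x)) ->
  #|F| <= set_card A * #|H|.
Proof.
move=> finA Af fh_inj; rewrite cardE -(size_map (fun x => (f x, h x))).
rewrite (cardE H) /set_card -(size_allpairs pair).
apply: uniq_leq_size; first by rewrite map_inj_uniq// enum_uniq.
move=> _ /mapP[x _ ->]; apply: allpairs_f; last exact: mem_enum.
by rewrite in_fset_set// inE.
Qed.

Lemma set_card_le (T : choiceType) (A B : set T) :
  finite_set B -> A `<=` B -> set_card A <= set_card B.
Proof.
move=> finB AB; apply: fsubset_leq_card.
by rewrite -fset_set_sub//; exact: sub_finite_set finB.
Qed.

(** * Coordinates of one-particle indices *)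

(* The number of coordinates of a one-particle index besides [m], i.e. d - 1. *)
Definition extra_dim (G : symmetry_group) : nat :=
  match G with Torus => 0 | SO2 => 1 | O3 => 2 end.

(* For [O3] with [l < `|m|] this is the junk value [(0, 0, 0)]. *)
Definition build_particle (G : symmetry_group) (a l : nat) (m : int) : particle G :=
  match G with
  | Torus => m
  | SO2 => (a, m)
  | O3 => insubd (exist (fun k : nat * nat * int => `|k.2|%N <= k.1.2) (0, 0, 0%R) isT) (a, l, m)
  end.
Arguments build_particle : clear implicits.

Section BuildParticle.
Variables (G : symmetry_group) (a l : nat) (m : int).
Hypothesis ml : `|m| <= l.

Lemma particle_m_build : particle_m (build_particle G a l m) = m.
Proof. by case: G => //=; rewrite insubdK. Qed.

Lemma particle_degree_build : particle_degree (build_particle G a l m) <= a + l.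
Proof. by case: G => /=; rewrite ?insubdK //=; lia. Qed.

Lemma build_particle_inj a' l' m' : `|m'| <= l' ->
    build_particle G a l m = build_particle G a' l' m' ->
  [/\ m = m', 0 < extra_dim G -> a = a' & 1 < extra_dim G -> l = l'].
Proof.
case: G => //= ml'; [by case=> -> ->|].
by move=> /(congr1 val); rewrite !insubdK//= => -[-> -> ->].
Qed.

End BuildParticle.

Definition coord d L (e : d.-tuple 'I_L.+1) i : nat := nth ord0 e i.

Lemma coord_inj d L (e e' : d.-tuple 'I_L.+1) :
  (forall i, i < d -> coord e i = coord e' i) -> e = e'.
Proof.
move=> ee'; apply/val_inj/(@eq_from_nth _ ord0); first by rewrite !size_tuple.
by move=> i; rewrite size_tuple => id; apply/val_inj/ee'.
Qed.

Lemma coord_le d L (e : d.-tuple 'I_L.+1) i : coord e i <= L.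
Proof. by rewrite /coord -ltnS. Qed.

Lemma build_particle_surj G D (k : particle G) : particle_degree k <= D ->
  exists c : (extra_dim G).-tuple 'I_D.+1 * 'I_(2 * D).+1,
    build_particle G (coord c.1 0) (coord c.1 1) (c.2%:Z - D%:Z)%R = k.
Proof.
(* The values of [m] from [-D] to [D] are shifted by [D] to become ordinals. *)
have mE (m : int) : `|m| <= D -> ((inord (absz (m + D%:Z)) : 'I_(2 * D).+1)%:Z - D%:Z)%R = m.
  by move=> mD; rewrite inordK; lia.
case: G k => [m|[a m]|k] /= kD.
- by exists ([tuple], inord (absz (m + D%:Z)%R)); rewrite /= mE.
- exists ([tuple inord a], inord (absz (m + D%:Z)%R)).
  by rewrite /= mE /coord/= ?inordK//; lia.
- case: k kD => [[[a l] m] /= lm] kD.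
  exists ([tuple inord a; inord l], inord (absz (m + D%:Z)%R)).
  apply: val_inj; rewrite /= mE /coord/= ?inordK ?insubdK//; lia.
Qed.

(** * Upper bound on the number of nodes of bounded order and degree *)

(** Nodes are decoded from [r]-tuples of optional codes; [None] pads nodes with fewer than [r]
    elements and accounts for the outer successor in the base. *)
Lemma bounded_nodes_card G r D (A : set (node G)) :
    (forall k, A k -> size k <= r /\ degree k <= D) ->
  finite_set A /\ set_card A <= ((D.+1 ^ extra_dim G * (2 * D).+1).+1) ^ r.
Proof.
move=> Ab; pose C := ((extra_dim G).-tuple 'I_D.+1 * 'I_(2 * D).+1)%type.
pose dec (c : C) := build_particle G (coord c.1 0) (coord c.1 1) (c.2%:Z - D%:Z)%R.
have -> : ((D.+1 ^ extra_dim G * (2 * D).+1).+1) ^ r = #|{:r.-tuple (option C)}|.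
  by rewrite card_tuple card_option card_prod card_tuple !card_ord.
apply: (set_card_le_surj (f := fun t : r.-tuple (option C) =>
          seq_mset (pmap (omap dec) t))) => k /Ab[kr kD].
have [s sE] : exists s : seq C, map dec s = enum_mset k.
  have : forall i, i \in enum_mset k -> exists c, dec c = i.
    by move=> i /particle_degree_le ik; apply: build_particle_surj; lia.
  elim: (enum_mset k) => [|x s IHs] cs; first by exists [::].
  have [t <-] := IHs (fun i si => cs i (mem_behead (s := x :: s) si)).
  by have [c <-] := cs x (mem_head _ _); exists (c :: t).
have tP : size (map Some s ++ nseq (r - size (k : node G)) None) == r.
  by rewrite size_cat size_nseq size_map -(size_map dec) sE subnKC.
exists (Tuple tP) => /=; rewrite pmap_cat.
have -> : pmap (omap dec) (nseq (r - size (k : node G)) None) = [::].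
  by elim: (r - size (k : node G)).
rewrite cats0; have -> : pmap (omap dec) (map Some s) = map dec s.
  by elim: (s) => //= c s' ->.
by rewrite sE seq_mset_id.
Qed.

Lemma K_set_finite G r D : finite_set (K_set G r D).
Proof. by apply: (proj1 (@bounded_nodes_card G r D _ _)) => k [_ kD <-]. Qed.

(** * Lower bound on the number of invariant nodes *)

Section BalancedNodes.
Variables (G : symmetry_group) (r L : nat).

(* The coordinates besides [m] of all particles, and all the [m]'s but the last,
   which is minus the sum of the others. *)
Definition balanced_code : finType :=
  ({ffun 'I_r.+1 -> (extra_dim G).-tuple 'I_L.+1} * {ffun 'I_r -> 'I_L.+1})%type.
Implicit Types c : balanced_code.

Definition balanced_m c (i : 'I_r.+1) : int :=
  if unlift ord_max i is Some j then c.2 j : nat else (- \sum_j ((c.2 j : nat)%:Z))%R.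

(* [l] is even, so that the parity condition of [O3] holds, and at least
   [(r + 1) L], which bounds [|m|]. *)
Definition balanced_l c (i : 'I_r.+1) : nat := 2 * (r.+1 * L + coord (c.1 i) 1).

Definition balanced_particle c (i : 'I_r.+1) : particle G :=
  build_particle G (coord (c.1 i) 0) (balanced_l c i) (balanced_m c i).

Definition balanced_node c : node G :=
  seq_mset [seq balanced_particle c i | i : 'I_r.+1].

Lemma balanced_m_le c i : `|balanced_m c i| <= balanced_l c i.
Proof.
have sum_le : (\sum_j (c.2 j : nat)) <= r * L.
  by rewrite -[X in X * L](card_ord r) -sum_nat_const leq_sum// => j _; rewrite -ltnS.
rewrite /balanced_m /balanced_l; case: unliftP => [j|] _.
  by have := ltn_ord (c.2 j); lia.
have -> : (\sum_j ((c.2 j : nat)%:Z))%R = (\sum_j (c.2 j : nat))%N%:Z.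
  by rewrite (big_morph Posz PoszD (erefl _)).
lia.
Qed.

Lemma size_balanced_node c : size (balanced_node c) = r.+1.
Proof. by rewrite (perm_size (perm_eq_seq_mset _)) size_map -cardE card_ord. Qed.

Lemma big_balanced_node (R : Type) (idx : R) (op : Monoid.com_law idx) F c :
  \big[op/idx]_(p <- balanced_node c) F p =
  \big[op/idx]_i F (balanced_particle c i).
Proof. by rewrite (perm_big _ (perm_eq_seq_mset _)) big_image. Qed.

(* A multiset of [r.+1] particles and the position in its enumeration of each
   entry determine the tuple; so at most [r.+1 ^ r.+1] tuples give the same node. *)
Lemma balanced_node_inj :
  injective (fun c => (balanced_node c,
    [ffun i : 'I_r.+1 => inord (index (balanced_particle c i) (balanced_node c)) : 'I_r.+1])).
Proof.
move=> c c' [nodeE /ffunP idxE].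
have pE i : balanced_particle c i = balanced_particle c' i.
  have mem d : balanced_particle d i \in enum_mset (balanced_node d).
    by rewrite (perm_mem (perm_eq_seq_mset _)) fintype.image_f.
  have idx_lt d : index (balanced_particle d i) (balanced_node d) < r.+1.
    by rewrite -(size_balanced_node d) index_mem.
  have := idxE i; rewrite !ffunE => /(congr1 val); rewrite /= !inordK// => iE.
  by rewrite -[LHS](nth_index (balanced_particle c i) (mem c)) iE nodeE nth_index.
case: c c' pE {nodeE idxE} => [e g] [e' g'] pE.
have {}pE i := build_particle_inj (balanced_m_le _ i) (balanced_m_le _ i) (pE i).
congr (_, _); apply/ffunP => i.
  apply: coord_inj => -[|[|j]] jG.
  - by case: (pE i) => _ + _; apply.
  - by case: (pE i) => _ _ /(_ jG); rewrite /balanced_l /=; lia.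
  - by have : extra_dim G <= 2 by [case: (G)]; lia.
case: (pE (lift ord_max i)) => + _ _; rewrite /balanced_m liftK /= => -[gE].
exact: val_inj.
Qed.

End BalancedNodes.

Lemma even_l_balanced_node G r L (c : balanced_code G r L) :
  even_l (balanced_node c).
Proof.
case: G c => // c; rewrite /even_l big_balanced_node.
rewrite (eq_bigr (balanced_l c)) => [|i _].
  by rewrite /balanced_l -big_distrr oddM.
by rewrite /= insubdK //; exact: balanced_m_le.
Qed.

(** Each of the [r.+1] particles has degree at most [L + 2 * (r.+1 * L + L)], which is
    [(2 * r + 5) * L]. *)
Lemma balanced_node_K G r L D (c : balanced_code G r L) : r.+1 * (2 * r + 5) * L <= D ->
  K_set G r.+1 D (balanced_node c).
Proof.
move=> LD; split; last exact: size_balanced_node.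
- split; first by rewrite size_balanced_node.
  + rewrite big_balanced_node.
    under eq_bigr do rewrite particle_m_build ?balanced_m_le//.
    rewrite (bigD1_ord ord_max)//= {1}/balanced_m unlift_none.
    under [X in (_ + X)%R]eq_bigr do rewrite /balanced_m liftK.
    by rewrite addNr.
  + exact: even_l_balanced_node.
rewrite /degree big_balanced_node; apply: leq_trans LD.
rewrite -mulnA -[X in X * _](card_ord r.+1) -sum_nat_const leq_sum// => i _.
apply: leq_trans (particle_degree_build G (coord (c.1 i) 0) (balanced_m_le c i)) _.
by have := coord_le (c.1 i) 0; have := coord_le (c.1 i) 1; rewrite /balanced_l; nia.
Qed.

(** With [L = D %/ c] there are [L.+1 ^ N] codes, and [D <= c * L.+1]. The factor [r.+1 ^ r.+1]
    bounds the fibres of [balanced_node]. *)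
Lemma K_set_card_ge G r D (c := r.+1 * (2 * r + 5)) (N := extra_dim G * r.+1 + r) :
  D ^ N <= c ^ N * (set_card (K_set G r.+1 D) * r.+1 ^ r.+1).
Proof.
have c0 : 0 < c by rewrite /c; lia.
have LD : c * (D %/ c) <= D by rewrite mulnC leq_trunc_div.
have := @card_le_fibered _ _ _ _ _ _ (K_set_finite G r.+1 D)
  (fun x => balanced_node_K x LD) (@balanced_node_inj G r (D %/ c)).
rewrite card_prod !card_ffun card_tuple !card_ord -expnM -expnD -/N => Kge.
apply: leq_trans (leq_mul (leqnn (c ^ N)) Kge).
rewrite -expnMn; case: N {Kge} => // N; rewrite leq_exp2r//.
by have := divn_eq D c; have := ltn_pmod D c0; nia.
Qed.

(** * Comparison of the two counts *)

Lemma auxiliary_card_le G n nu : 0 < n -> 2 * n <= nu ->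
  exists C, forall D S, 0 < D -> final_graph n nu D S ->
    set_card (@auxiliary_nodes G nu D S) * D ^ ((extra_dim G).+1 * n).-1 <=
      C * set_card (V_set nu D S).
Proof.
case: nu => [|r] n0 n_le; first lia.
set e := extra_dim G; pose N := e * r.+1 + r.
pose c := r.+1 * (2 * r + 5); pose B := 2 ^ e * 3 + 1.
exists (B ^ (r.+1 - n) * (c ^ N * r.+1 ^ r.+1)) => D S D0 finS.
have [_ Ale] := bounded_nodes_card (fun q => @auxiliary_bounded _ _ _ _ _ q n0 n_le finS).
have finV : finite_set (V_set r.+1 D S).
  apply: (proj1 (@bounded_nodes_card G r.+1 D _ _)) => k [|[i /= ? [_ kD ki]]]; last lia.
  by case/(auxiliary_bounded n0 n_le finS) => *; lia.
have KV : set_card (K_set G r.+1 D) <= set_card (V_set r.+1 D S).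
  by apply: set_card_le => // k Kk; right; exists r.+1 => //=; lia.
(* For [D >= 1], [D.+1 <= 2 * D], [(2 * D).+1 <= 3 * D] and [1 <= D ^ e.+1]; this gives [B]. *)
have boxle : (D.+1 ^ e * (2 * D).+1).+1 <= B * D ^ e.+1.
  have De : D.+1 ^ e <= 2 ^ e * D ^ e.
    by rewrite -expnMn; case: (e) => // e'; rewrite leq_exp2r //; lia.
  have : 0 < D ^ e.+1 by rewrite expn_gt0 D0.
  by move: De; rewrite /B expnS; move: (D ^ e) (2 ^ e) (D.+1 ^ e) => x y z; nia.
have {}Ale : set_card (auxiliary_nodes r.+1 D S) <= B ^ (r.+1 - n) * D ^ (e.+1 * (r.+1 - n)).
  apply: leq_trans Ale _; rewrite expnM -expnMn leq_exp2r //; lia.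
(* Both sides have exponent [e.+1 * r.+1 - 1], the growth order of the invariant nodes. *)
have DN : D ^ (e.+1 * (r.+1 - n)) * D ^ (e.+1 * n).-1 = D ^ N.
  by rewrite -expnD; congr (D ^ _); rewrite /N; nia.
apply: leq_trans (leq_mul Ale (leqnn _)) _.
rewrite -mulnA DN -!mulnA leq_mul2l; apply/orP; right.
apply: leq_trans (K_set_card_ge G r D) _; rewrite -/e -/N -/c leq_mul2l.
by apply/orP; right; rewrite mulnC leq_mul2l KV orbT.
Qed.

Local Close Scope nat_scope.

Theorem theorem3p3 (R : realType) (G : symmetry_group) (n nu : nat)
    (n_ge1 : (1 <= n)%N) (n_le : (2 * n <= nu)%N)
    (S : nat -> set (node G))
    (S_final : forall D, (1 <= D)%N -> final_graph n nu D (S D)) :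
  (fun D : nat =>
     (set_card (auxiliary_nodes nu D (S D)))%:R / (set_card (V_set nu D (S D)))%:R : R)
  =O_\oo
  (fun D : nat => D%:R ^ match G with
                         | Torus => 1 - n%:Z
                         | SO2 => 1 - 2 * n%:Z
                         | O3 => 1 - 3 * n%:Z
                         end : R).
Proof.
have [C CP] := auxiliary_card_le G n_ge1 n_le.
set N := ((extra_dim G).+1 * n)%N.
have N1 : (0 < N)%N by rewrite muln_gt0.
have expE : match G with
            | Torus => 1 - n%:Z | SO2 => 1 - 2 * n%:Z | O3 => 1 - 3 * n%:Z
            end = - (N.-1)%:Z.
  by move: N1; rewrite /N; case: (G) => /=; lia.
(* Adding 1 keeps the constant positive when [C] is 0. *)
apply/eqO_exP; exists (C%:R + 1); first by rewrite ltr_wpDl.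
near=> D; have D1 : (1 <= D)%N by near: D; exact: nbhs_infty_ge.
have D0 : 0 < (D%:R : R) ^+ N.-1 by rewrite exprn_gt0 // ltr0n.
rewrite expE -exprnN !ger0_norm ?invr_ge0 ?(ltW D0) ?divr_ge0 //.
have := CP D _ D1 (S_final D D1); rewrite -/N -(ler_nat R) !natrM natrX.
set a := (set_card (auxiliary_nodes _ _ _))%:R; set v := (set_card (V_set _ _ _))%:R.
move=> av; have := ler0n R (set_card (V_set nu D (S D))).
rewrite le_eqVlt => /predU1P[v0|v0].
  (* If the denominator is 0, the quotient is 0 by convention. *)
  by rewrite /v -v0 invr0 mulr0 mulr_ge0 ?invr_ge0 ?(ltW D0) ?addr_ge0.
rewrite ler_pdivrMr // mulrAC ler_pdivlMr // (le_trans av) //.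
by rewrite mulrDl mul1r lerDl ltW.
Unshelve. all: by end_near.
Qed.
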